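(* There is a universal constant $c_0>0$ such that for all universal constants $0<c_2\le c_1\le c_0$ there exists a universal constant $c_3>0$ such that the following holds. Let $\delta\in(0,1)$, $\gamma\in(0,1)$ and $\varepsilon\in\big(0,\frac1{1-\gamma}\big]$. Suppose that for all $0\le t\le T$, $\frac{1}{1+c_1(1-\gamma)T/\log^3T}\le\eta_t\le\frac{1}{1+c_2(1-\gamma)t/\log^3T}$, and $$T\ge\frac{c_3(\log^4T)\,\log\frac{|\mathcal S||\mathcal A|T}{\delta}}{\gamma^2(1-\gamma)^4\min\{\varepsilon^2,\varepsilon\}}.$$ If $0\le Q_0(s,a)\le\frac1{1-\gamma}$ for all $(s,a)$, then with probability at least $1-\delta$, synchronous Q-learning satisfies $\max_{(s,a)}|Q_T(s,a)-Q^\star(s,a)|\le\varepsilon$.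
   Context: A discounted MDP $(\mathcal S,\mathcal A,P,r,\gamma)$ has finite state space $\mathcal S$, finite action space $\mathcal A$, transition kernel $P(\cdot\mid s,a)\in\Delta(\mathcal S)$, reward $r:\mathcal S\times\mathcal A\to[0,1]$ and discount $\gamma\in(0,1)$. For a policy $\pi$, $Q^\pi(s,a)=\mathbb E[\sum_{k\ge0}\gamma^k r(s_k,a_k)\mid s_0=s,a_0=a]$; $Q^\star(s,a)=\max_\pi Q^\pi(s,a)$, $V^\star(s)=\max_aQ^\star(s,a)$. Synchronous Q-learning: in each iteration $t=1,\dots,T$, for each $(s,a)$ an independent sample $s_t(s,a)\sim P(\cdot\mid s,a)$ is drawn (independent across pairs and iterations), and $Q_t(s,a)=(1-\eta_t)Q_{t-1}(s,a)+\eta_t\big(r(s,a)+\gamma\max_{a'}Q_{t-1}(s_t(s,a),a')\big)$, with $\eta_t\in(0,1]$; $V_t(s)=\max_aQ_t(s,a)$. Logarithms are natural. *)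

(* Defs.v *)
From HB Require Import structures.
From mathcomp Require Import all_boot all_order all_algebra.
From mathcomp Require Import all_classical all_reals all_analysis.
Set Implicit Arguments. Unset Strict Implicit. Unset Printing Implicit Defensive.
Import Order.TTheory GRing.Theory Num.Theory.
Local Open Scope ring_scope.
Local Open Scope classical_set_scope.

Section QL.
Variables (R : realType) (S A : finType).

Definition is_kernel (P : S -> A -> S -> R) : Prop :=
  forall s a, (forall s', 0 <= P s a s') /\ \sum_(s' : S) P s a s' = 1.

Definition is_policy (pi : S -> A -> R) : Prop :=
  forall s, (forall a, 0 <= pi s a) /\ \sum_(a : A) pi s a = 1.

Fixpoint state_action_law (P : S -> A -> S -> R) (pi : S -> A -> R)
    (s : S) (a : A) (k : nat) : S -> A -> R :=
  match k with
  | 0 => fun s' a' => if (s' == s) && (a' == a) then 1 else 0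
  | k.+1 => fun s' a' =>
      \sum_(x : S) \sum_(y : A)
         state_action_law P pi s a k x y * P x y s' * pi s' a'
  end.

(* Q^pi(s,a) = E[ sum_k gamma^k r(s_k,a_k) | s_0=s, a_0=a ] *)
Definition Qpi (P : S -> A -> S -> R) (r : S -> A -> R) (gamma : R)
    (pi : S -> A -> R) (s : S) (a : A) : R :=
  limn (fun n => \sum_(k < n)
     gamma ^+ k * \sum_(x : S) \sum_(y : A)
        state_action_law P pi s a k x y * r x y).

Definition Qstar (P : S -> A -> S -> R) (r : S -> A -> R) (gamma : R)
    (s : S) (a : A) : R :=
  sup [set Qpi P r gamma pi s a | pi in is_policy].

(* max_a Q(s,a); a0 only supplies the seed of the (nonempty) max *)
Definition Vmax (a0 : A) (Q : S -> A -> R) (s : S) : R :=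
  \big[Num.max/Q s a0]_(a : A) Q s a.

(* Samples: omega (t, s, a) = s_{t+1}(s,a), for t < T *)
Definition sample_space (T : nat) := {ffun 'I_T * S * A -> S}.

(* Synchronous Q-learning iterate Q_t driven by the sample function smp t s a
   = s_t(s,a) (used for t >= 1). *)
Fixpoint Qlearn (a0 : A) (r : S -> A -> R) (gamma : R) (eta : nat -> R)
    (Q0 : S -> A -> R) (smp : nat -> S -> A -> S) (t : nat) : S -> A -> R :=
  match t with
  | 0 => Q0
  | t'.+1 => fun s a =>
      (1 - eta t) * Qlearn a0 r gamma eta Q0 smp t' s a
      + eta t * (r s a + gamma *
                 Vmax a0 (Qlearn a0 r gamma eta Q0 smp t') (smp t s a))
  end.

(* read a sample path as s_t(s,a), t = 1..T *)
Definition sample_of (T : nat) (w : sample_space T) : nat -> S -> A -> S :=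
  fun t s a => match insub t.-1 with
               | Some i => w (i, s, a)
               | None => s
               end.

(* probability of a sample path: independent draws s_t(s,a) ~ P(.|s,a) *)
Definition path_prob (P : S -> A -> S -> R) (T : nat) (w : sample_space T) : R :=
  \prod_(x : 'I_T * S * A) P x.1.2 x.2 (w x).

Definition prob_event (P : S -> A -> S -> R) (T : nat)
    (E : pred (sample_space T)) : R :=
  \sum_(w : sample_space T | E w) path_prob P w.

Definition sup_err (Q Q' : S -> A -> R) : R :=
  \big[Num.max/0]_(x : S * A) `|Q x.1 x.2 - Q' x.1 x.2|.

End QL.

(* Main.v *)
Require Import Defs.
From HB Require Import structures.
From mathcomp Require Import all_boot all_order all_algebra.
From mathcomp Require Import all_classical all_reals all_analysis.
From mathcomp Require Import ring lra zify.
Set Implicit Arguments. Unset Strict Implicit. Unset Printing Implicit Defensive.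
Import Order.TTheory GRing.Theory Num.Theory.
Import numFieldNormedType.Exports.
Local Open Scope ring_scope.

(** Let [N] be the exponentially weighted sum of the sampling errors of Q-learning
    made after time [T./2]. Its exponential moments are controlled by a supermartingale
    at one fixed parameter, so that, uniformly over time and state-action pairs,
    [|N| <= lam * noise_var + b], where [noise_var] averages the one-step variances of
    the current value function. These exceed twice the variance of [V*] by at most a
    multiple of [1 / (1 - gamma)] times the current error.

    The variance of [V*] is absorbed by a potential instead of being summed along
    trajectories: since [Q* - r = gamma P V*], applying [gamma P] to [- kap * V* ^+ 2]
    gives at most [- kap * Q* ^+ 2 - kap * gamma ^+ 2 * Var(V* )], up to an error
    [2 * kap / (1 - gamma)]. Hence the error minus the noise stays below
    [eps / 2 - kap * Q* ^+ 2] plus a transient decaying at rate [eta (1 - gamma) / 2];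
    taking [kap] of order [(1 - gamma) ^+ 2 * min 1 eps] gives the exponent 4. *)

(** * Finite means and variances *)

Section FiniteMean.
Variables (R : realType) (B : finType).
Implicit Types (p f h : B -> R).

Definition is_dist p := (forall y, 0 <= p y) /\ \sum_y p y = 1.

Definition mean p f := \sum_y p y * f y.

Definition dvariance p f := mean p (fun y => (f y - mean p f) ^+ 2).

Lemma mean_cst p (c : R) : is_dist p -> mean p (fun=> c) = c.
Proof. by move=> [_ p1]; rewrite /mean -mulr_suml p1 mul1r. Qed.

Lemma mean_lin p (a b : R) f h :
  mean p (fun y => a * f y + b * h y) = a * mean p f + b * mean p h.
Proof.
rewrite /mean !mulr_sumr -big_split /=; apply: eq_bigr => y _; ring.
Qed.

Lemma mean_le p f h : is_dist p -> (forall y, f y <= h y) -> mean p f <= mean p h.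
Proof. by move=> [p0 _] fh; apply: ler_sum => y _; apply: ler_wpM2l. Qed.

Lemma mean_ge_cst p f (c : R) :
  is_dist p -> (forall y, c <= f y) -> c <= mean p f.
Proof. by move=> dp cf; rewrite -[leLHS](mean_cst c dp); apply: mean_le. Qed.

Lemma mean_le_cst p f (c : R) :
  is_dist p -> (forall y, f y <= c) -> mean p f <= c.
Proof. by move=> dp cf; rewrite -[leRHS](mean_cst c dp); apply: mean_le. Qed.

Lemma eq_mean p f h : (forall y, f y = h y) -> mean p f = mean p h.
Proof. by move=> fh; apply: eq_bigr => y _; rewrite fh. Qed.

Lemma meanB p f h : mean p (fun y => f y - h y) = mean p f - mean p h.
Proof.
rewrite -[mean p f]mul1r -[X in _ - X]mul1r -mulNr -mean_lin.
by apply: eq_mean => y; rewrite mul1r mulN1r.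
Qed.

Lemma dvariance_ge0 p f : is_dist p -> 0 <= dvariance p f.
Proof. by move=> dp; apply: mean_ge_cst => // y; apply: sqr_ge0. Qed.

Lemma dvarianceE p f : is_dist p ->
  dvariance p f = mean p (fun y => f y ^+ 2) - mean p f ^+ 2.
Proof.
move=> dp; set m := mean p f.
have -> : dvariance p f
    = mean p (fun y => 1 * (1 * f y ^+ 2 + (- 2 * m) * f y) + m ^+ 2 * 1).
  by apply: eq_mean => y; rewrite -/m; ring.
rewrite (mean_lin p 1 (m ^+ 2) _ (fun=> 1)) mean_lin mean_cst // -/m; ring.
Qed.

(** The variance of [f - h] is at most its second moment, hence at most [x ^+ 2]; the rest is
    [(a + b) ^+ 2 <= 2 * a ^+ 2 + 2 * b ^+ 2] for the centred variables. *)
Lemma dvariance_perturb p f h (x : R) : is_dist p ->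
  (forall y, `|f y - h y| <= x) -> dvariance p f <= 2 * dvariance p h + 2 * x ^+ 2.
Proof.
move=> dp fh; pose u y := f y - h y.
have uE : dvariance p u <= x ^+ 2.
  rewrite dvarianceE // lerBlDr; apply: le_trans (_ : x ^+ 2 <= _); last first.
    by rewrite lerDl sqr_ge0.
  apply: mean_le_cst => // y; rewrite -[u y ^+ 2]real_normK ?num_real //.
  by rewrite ler_pXn2r ?nnegrE // (le_trans _ (fh y)).
apply: (@le_trans _ _ (2 * dvariance p h + 2 * dvariance p u)); last first.
  by rewrite lerD2l ler_pM2l.
rewrite -mean_lin; apply: mean_le => // y.
rewrite meanB /u; set a := f y; set b := h y; set c := mean p f; set d := mean p h.
rewrite -subr_ge0.
have -> : 2 * (b - d) ^+ 2 + 2 * (a - b - (c - d)) ^+ 2 - (a - c) ^+ 2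
    = (2 * (b - d) - (a - c)) ^+ 2 by ring.
exact: sqr_ge0.
Qed.

(** Inverting [1 - x <= expR (- x)] gives [expR x <= 1 / (1 - x)], and [(1 - x) * (1 + x + 2 * x ^+
    2) = 1 + x ^+ 2 * (1 - 2 * x)]. *)
Lemma expR_le_quadratic (x : R) : x <= 1 / 2 -> expR x <= 1 + x + 2 * x ^+ 2.
Proof.
move=> x2; have x1 : 0 < 1 - x by lra.
have : 1 - x <= expR (- x) by rewrite expR_ge1Dx.
rewrite expRN => h.
have : expR x <= (1 - x)^-1 by rewrite -[expR x]invrK lef_pV2 ?posrE ?invr_gt0 ?expR_gt0.
move/le_trans; apply; rewrite -div1r ler_pdivrMr //.
have : 0 <= x ^+ 2 * (1 - 2 * x) by rewrite mulr_ge0 ?sqr_ge0 //; lra.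
rewrite !expr2; nra.
Qed.

(** A Bernstein-type estimate: in the quadratic bound on [expR] the linear term has mean zero, so
    only the variance survives. *)
Lemma mgf_le_dvariance p f (u : R) : is_dist p ->
  (forall y, `|u * (f y - mean p f)| <= 1 / 2) ->
  mean p (fun y => expR (u * (f y - mean p f))) <= expR (2 * u ^+ 2 * dvariance p f).
Proof.
move=> dp uf; apply: le_trans (expR_ge1Dx _); set m := mean p f.
have -> : 1 + 2 * u ^+ 2 * dvariance p f =
    mean p (fun y => 1 * (u * (f y - m) + 1 * 1) + (2 * u ^+ 2) * (f y - m) ^+ 2).
  rewrite mean_lin mean_lin mean_cst // meanB mean_cst // -/m /dvariance; ring.
apply: mean_le => // y; apply: le_trans (expR_le_quadratic _) _.
  exact: le_trans (ler_norm _) (uf y).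
by rewrite le_eqVlt; apply/orP; left; apply/eqP; ring.
Qed.

End FiniteMean.

(** * Finite product laws and resampling of one coordinate *)

Section ProductLaw.
Variables (R : realType) (I B : finType) (p : I -> B -> R).
Hypothesis dp : forall x, is_dist (p x).

Definition product_law (w : {ffun I -> B}) : R := \prod_x p x (w x).

Definition update (w : {ffun I -> B}) (x0 : I) (y : B) : {ffun I -> B} :=
  [ffun x => if x == x0 then y else w x].

Lemma product_law_ge0 w : 0 <= product_law w.
Proof. by apply: prodr_ge0 => x _; have [] := dp x. Qed.

Lemma product_law_sum1 : \sum_w product_law w = 1.
Proof.
rewrite /product_law -(bigA_distr_bigA (fun x y => p x y)) /=.
by rewrite big1 // => x _; have [] := dp x.
Qed.

(* Swapping [w x0] with the fresh draw [y] is a measure-preserving involution. *)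
Lemma resample (x0 : I) (F : {ffun I -> B} -> R) :
  mean product_law F = mean product_law (fun w => mean (p x0) (F \o update w x0)).
Proof.
have split_x0 w : product_law w = p x0 (w x0) * \prod_(x | x != x0) p x (w x).
  by rewrite /product_law (bigD1 x0).
rewrite /mean.
transitivity (\sum_(z : {ffun I -> B} * B) product_law z.1 * (p x0 z.2 * F z.1)).
  rewrite -(pair_bigA _ (fun w y => product_law w * (p x0 y * F w))) /=.
  apply: eq_bigr => w _; rewrite -mulr_sumr -mulr_suml.
  by have [_ ->] := dp x0; rewrite mul1r.
pose swap (z : {ffun I -> B} * B) := (update z.1 x0 z.2, z.1 x0).
have swapK : involutive swap.
  move=> [w y]; rewrite /swap /=; congr pair; last by rewrite ffunE eqxx.
  by apply/ffunP => x; rewrite !ffunE; case: eqP => // ->.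
rewrite (reindex_inj (inv_inj swapK)) /=.
under [RHS]eq_bigr do rewrite mulr_sumr.
rewrite (pair_bigA _ (fun w y => product_law w * (p x0 y * F (update w x0 y)))) /=.
apply: eq_bigr => -[w y] _ /=; rewrite !mulrA; congr (_ * _).
rewrite !split_x0 ffunE eqxx.
rewrite (eq_bigr (fun x => p x (w x))) => [|x xx0]; first by ring.
by rewrite ffunE (negbTE xx0).
Qed.

End ProductLaw.

(** * Bellman optimality of [Qstar] *)

Section Bellman.
Variables (R : realType) (S A : finType) (a0 : A).
Variables (P : S -> A -> S -> R) (r : S -> A -> R) (gamma : R).
Hypothesis kerP : is_kernel P.
Hypothesis r01 : forall s a, 0 <= r s a <= 1.
Hypothesis gamma01 : 0 < gamma < 1.

Local Notation H := (1 / (1 - gamma)).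

Let kerPd s a : is_dist (P s a).
Proof. by have [] := kerP s a. Qed.

(** The transition operator of the state-action chain under [pi], acting backwards on functions,
    whereas [state_action_law] moves the law forwards. *)
Definition policy_op (pi : S -> A -> R) (f : S -> A -> R) : S -> A -> R :=
  fun s a => mean (P s a) (fun s' => mean (pi s') (f s')).

Lemma horizon_ge1 : 1 <= H.
Proof. by case/andP: gamma01 => g0 g1; rewrite ler_pdivlMr; lra. Qed.

Lemma horizonE : (1 - gamma) * H = 1.
Proof. by case/andP: gamma01 => g0 g1; rewrite mulrC divfK //; lra. Qed.

Lemma le_Vmax (Q : S -> A -> R) s a : Q s a <= Vmax a0 Q s.
Proof. by rewrite /Vmax; apply: le_bigmax_cond. Qed.

Lemma Vmax_attained (Q : S -> A -> R) s : exists a, Vmax a0 Q s = Q s a.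
Proof.
rewrite /Vmax; apply: (big_ind (fun x => exists a, x = Q s a)) => [|x y [a ->] [b ->]|a _].
- by exists a0.
- by case: (leP (Q s a) (Q s b)) => _; [exists b|exists a].
- by exists a.
Qed.

(** Minimum principle: at a minimiser the hypothesis yields [gamma * X <= X], and [gamma < 1]. It
    serves to compare the values of two policies. *)
Lemma policy_op_ge0 pi (X : S -> A -> R) : is_policy pi ->
  (forall s a, gamma * policy_op pi X s a <= X s a) -> forall s a, 0 <= X s a.
Proof.
case/andP: gamma01 => g0 g1 hpi hX s a.
case: (@arg_minP _ _ _ (s, a) xpredT (fun z => X z.1 z.2) isT) => -[s1 a1] _ /= mX.
apply: le_trans (mX (s, a) isT) => /=; have := hX s1 a1.
have : X s1 a1 <= policy_op pi X s1 a1.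
  apply: mean_ge_cst => // s'; apply: mean_ge_cst; first exact: hpi.
  by move=> a'; apply: (mX (s', a') isT).
set x := X s1 a1; set y := policy_op _ _ _ _ => xy yx.
have : (1 - gamma) * x >= 0 by nra.
by rewrite pmulr_rge0 //; lra.
Qed.

(** Duality of the forward law and the backward operator. [f] varies in the induction because the
    last transition is absorbed into it. *)
Lemma law_policy_op pi k f s a :
  \sum_x \sum_y state_action_law P pi s a k x y * f x y
    = iter k (policy_op pi) f s a.
Proof.
elim: k f => [|k IH] f /=.
  rewrite (bigD1 s) //= (bigD1 a) //= !eqxx mul1r.
  rewrite big1 ?addr0 => [|y /negbTE ya]; last by rewrite ya mul0r.
  rewrite big1 ?addr0 // => x /negbTE xs; rewrite big1 // => y _.
  by rewrite xs mul0r.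
rewrite -iterS iterSr -IH.
transitivity (\sum_s' \sum_a' \sum_x \sum_y
    state_action_law P pi s a k x y * P x y s' * pi s' a' * f s' a').
  apply: eq_bigr => s' _; apply: eq_bigr => a' _; rewrite mulr_suml.
  by apply: eq_bigr => x _; rewrite mulr_suml.
under eq_bigr do rewrite exchange_big /=.
rewrite exchange_big /=; apply: eq_bigr => x _.
under eq_bigr do rewrite exchange_big /=.
rewrite exchange_big /=; apply: eq_bigr => y _.
rewrite /policy_op /mean mulr_sumr; apply: eq_bigr => s' _.
rewrite !mulr_sumr; apply: eq_bigr => a' _; ring.
Qed.

Definition Qpartial pi n s a : R :=
  \sum_(k < n) gamma ^+ k * iter k (policy_op pi) r s a.

Lemma iter_policy_op01 pi k s a : is_policy pi ->
  0 <= iter k (policy_op pi) r s a <= 1.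
Proof.
move=> hpi; elim: k s a => [|k IH] s a //=; apply/andP; split.
  apply: mean_ge_cst => // s'; apply: mean_ge_cst; first exact: hpi.
  by move=> a'; have /andP[] := IH s' a'.
apply: mean_le_cst => // s'; apply: mean_le_cst; first exact: hpi.
by move=> a'; have /andP[] := IH s' a'.
Qed.

Lemma policy_op_sum pi n (F : nat -> S -> A -> R) s a :
  policy_op pi (fun s a => \sum_(k < n) F k s a) s a
    = \sum_(k < n) policy_op pi (F k) s a.
Proof.
rewrite /policy_op /mean exchange_big /=; apply: eq_bigr => s' _.
rewrite -mulr_sumr; congr (_ * _); rewrite exchange_big /=.
by apply: eq_bigr => a' _; rewrite mulr_sumr.
Qed.

Lemma policy_opZ pi (c : R) f s a :
  policy_op pi (fun s a => c * f s a) s a = c * policy_op pi f s a.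
Proof.
rewrite /policy_op /mean mulr_sumr; apply: eq_bigr => s' _.
rewrite mulrCA; congr (_ * _); rewrite mulr_sumr.
by apply: eq_bigr => a' _; rewrite mulrCA.
Qed.

Lemma policy_opB pi f h s a :
  policy_op pi (fun s a => f s a - h s a) s a = policy_op pi f s a - policy_op pi h s a.
Proof.
by rewrite /policy_op -meanB; apply: eq_mean => s'; rewrite meanB.
Qed.

Lemma QpartialS pi n s a :
  Qpartial pi n.+1 s a = r s a + gamma * policy_op pi (Qpartial pi n) s a.
Proof.
rewrite /Qpartial big_ord_recl /= expr0 mul1r; congr (_ + _).
rewrite (policy_op_sum pi n (fun k s a => gamma ^+ k * iter k (policy_op pi) r s a)).
rewrite mulr_sumr; apply: eq_bigr => k _.
by rewrite policy_opZ mulrA -exprS.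
Qed.

Lemma Qpartial_bounds pi n s a : is_policy pi -> 0 <= Qpartial pi n s a <= H.
Proof.
case/andP: gamma01 => g0 g1 hpi; elim: n s a => [|n IH] s a.
  by rewrite /Qpartial big_ord0 lexx; have := horizon_ge1; lra.
rewrite QpartialS; set x := policy_op _ _ _ _.
have x0 : 0 <= x.
  apply: mean_ge_cst => // s'; apply: mean_ge_cst; first exact: hpi.
  by move=> a'; have /andP[] := IH s' a'.
have x1 : x <= H.
  apply: mean_le_cst => // s'; apply: mean_le_cst; first exact: hpi.
  by move=> a'; have /andP[] := IH s' a'.
have := r01 s a; have := horizonE; move: (H) x1 => h x1 hE /andP[ra rb].
by apply/andP; split; nra.
Qed.

Lemma Qpartial_cvg pi s a : is_policy pi ->
  (Qpartial pi n s a @[n --> \oo] --> Qpi P r gamma pi s a)%classic.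
Proof.
case/andP: gamma01 => g0 g1 hpi.
have -> : Qpi P r gamma pi s a = limn (fun n => Qpartial pi n s a).
  rewrite /Qpi; congr (limn _); apply/funext => n; apply: eq_bigr => k _.
  by rewrite law_policy_op.
apply: nondecreasing_is_cvgn.
  apply/nondecreasing_seqP => n; rewrite /Qpartial big_ord_recr /= lerDl.
  by rewrite mulr_ge0 ?exprn_ge0 ?(ltW g0) //; have /andP[] := iter_policy_op01 n s a hpi.
by exists H => _ [n _ <-]; have /andP[] := Qpartial_bounds n s a hpi.
Qed.

(** The recursion [QpartialS] passes to the limit, since [policy_op] consists of finite sums. *)
Lemma Qpi_bellman pi s a : is_policy pi ->
  Qpi P r gamma pi s a = r s a + gamma * policy_op pi (Qpi P r gamma pi) s a.
Proof.
move=> hpi.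
have c1 : (Qpartial pi n.+1 s a @[n --> \oo] --> Qpi P r gamma pi s a)%classic.
  by rewrite (cvg_shiftS (fun n => Qpartial pi n s a)); apply: Qpartial_cvg.
apply: (cvg_unique _ c1) => //.
have -> : (fun n => Qpartial pi n.+1 s a)
    = (fun n => r s a + gamma * policy_op pi (Qpartial pi n) s a).
  by apply/funext => n; exact: QpartialS.
apply: cvgD; first exact: cvg_cst.
apply: cvgMl_tmp; rewrite /policy_op /mean.
apply: cvg_big => [|s' _]; first exact: add_continuous.
apply: cvgMl_tmp; apply: cvg_big => [|a' _]; first exact: add_continuous.
by apply: cvgMl_tmp; exact: Qpartial_cvg.
Qed.

Lemma Qpi_bounds pi s a : is_policy pi -> 0 <= Qpi P r gamma pi s a <= H.
Proof.
move=> hpi; have c := @Qpartial_cvg pi s a hpi; apply/andP; split.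
  apply: (cvgr_to_ge c); near=> n; by have /andP[] := Qpartial_bounds n s a hpi.
apply: (cvgr_to_le c); near=> n; by have /andP[] := Qpartial_bounds n s a hpi.
Unshelve. all: by end_near.
Qed.

Definition det_policy (f : S -> A) : S -> A -> R := fun s a => (a == f s)%:R.

Lemma mean_det_policy (f : S -> A) s (h : A -> R) : mean (det_policy f s) h = h (f s).
Proof.
rewrite /mean (bigD1 (f s)) //= /det_policy eqxx mul1r big1 ?addr0 // => a /negbTE ->.
by rewrite mul0r.
Qed.

Lemma det_policy_is_policy f : is_policy (det_policy f).
Proof.
move=> s; split=> [a|]; first exact: ler0n.
have := mean_det_policy f s (fun=> 1); rewrite /mean => <-.
by apply: eq_bigr => a _; rewrite mulr1.
Qed.

(* Policy improvement: the greedy policy [g] of a deterministic policy [f]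
   maximizing the total value does at least as well everywhere, so by maximality
   its value is that of [f]. *)
Lemma optimal_policy_exists : exists f : S -> A,
  let Qf := Qpi P r gamma (det_policy f) in
  forall s a, Qf s a = r s a + gamma * mean (P s a) (Vmax a0 Qf).
Proof.
case/andP: (gamma01) => g0 g1.
pose val (f : {ffun S -> A}) := Qpi P r gamma (det_policy f).
pose tot f := \sum_s \sum_a val f s a.
case: (@arg_maxP _ _ _ [ffun=> a0] xpredT tot isT) => f _ fmax.
have [g gE] : exists g : {ffun S -> A}, forall s, Vmax a0 (val f) s = val f s (g s).
  have /choice [g gE] := Vmax_attained (val f).
  by exists [ffun s => g s] => s; rewrite ffunE gE.
have bell (h : {ffun S -> A}) s a : val h s a
    = r s a + gamma * mean (P s a) (fun s' => val h s' (h s')).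
  rewrite /val Qpi_bellman; last exact: det_policy_is_policy.
  congr (_ + _ * _); rewrite /policy_op; apply: eq_mean => s'; exact: mean_det_policy.
have fg s a : 0 <= val g s a - val f s a.
  apply: (@policy_op_ge0 (det_policy g) (fun s a => val g s a - val f s a)) => {s a}.
    exact: det_policy_is_policy.
  move=> s a.
  have -> : policy_op (det_policy g) (fun s a => val g s a - val f s a) s a
      = mean (P s a) (fun s' => val g s' (g s')) - mean (P s a) (fun s' => val f s' (g s')).
    by rewrite -meanB /policy_op; apply: eq_mean => s'; rewrite mean_det_policy.
  rewrite (bell g) (bell f).
  have : mean (P s a) (fun s' => val f s' (f s')) <= mean (P s a) (fun s' => val f s' (g s')).
    by apply: mean_le => // s'; rewrite -gE le_Vmax.
  by rewrite -(ler_pM2l g0) => ?; lra.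
have fgE s a : val g s a = val f s a.
  apply/eqP; rewrite -subr_eq0; apply/eqP.
  have : \sum_z (val g z.1 z.2 - val f z.1 z.2) <= 0.
    rewrite sumrB subr_le0 -!(pair_bigA _ (fun s a => val _ s a)) /=.
    exact: fmax.
  move=> le0; have /eqP : \sum_z (val g z.1 z.2 - val f z.1 z.2) == 0.
    by rewrite eq_le le0 sumr_ge0 // => -[].
  move/psumr_eq0P => /(_ (fun z _ => fg z.1 z.2)) /(_ (s, a) isT) /=; exact.
exists f => /= s a; rewrite -/(val f) -fgE bell; congr (_ + _ * _).
by apply: eq_mean => s'; rewrite gE fgE.
Qed.

(** By the minimum principle the deterministic policy just found dominates every randomised one, so
    the supremum defining [Qstar] is attained and inherits its optimality equation. *)
Lemma Qstar_optimal : exists f : S -> A, Qstar P r gamma = Qpi P r gamma (det_policy f)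
  /\ forall s a, Qstar P r gamma s a
      = r s a + gamma * mean (P s a) (Vmax a0 (Qstar P r gamma)).
Proof.
case/andP: (gamma01) => g0 g1.
have [f fE] := optimal_policy_exists; exists f.
suff -> : Qstar P r gamma = Qpi P r gamma (det_policy f) by [].
apply/funext => s; apply/funext => a; apply/eqP; rewrite eq_le; apply/andP; split.
  apply: ge_sup; first by exists (Qpi P r gamma (det_policy f) s a);
    exists (det_policy f) => //; exact: det_policy_is_policy.
  move=> _ [pi hpi <-]; rewrite -subr_ge0.
  pose X s a := Qpi P r gamma (det_policy f) s a - Qpi P r gamma pi s a.
  rewrite -/(X s a); apply: (policy_op_ge0 hpi) => {s a} s a.
  rewrite policy_opB /X (Qpi_bellman s a hpi) fE.
  have : policy_op pi (Qpi P r gamma (det_policy f)) s a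
      <= mean (P s a) (Vmax a0 (Qpi P r gamma (det_policy f))).
    apply: mean_le => // s'; apply: mean_le_cst; first exact: hpi.
    by move=> a'; exact: le_Vmax.
  by rewrite -(ler_pM2l g0) => ?; lra.
apply: ub_le_sup; last by exists (det_policy f) => //; exact: det_policy_is_policy.
by exists H => _ [pi hpi <-]; have /andP[] := Qpi_bounds s a hpi.
Qed.

Lemma Qstar_bellman s a : Qstar P r gamma s a
  = r s a + gamma * mean (P s a) (Vmax a0 (Qstar P r gamma)).
Proof. by have [f [_ ->]] := Qstar_optimal. Qed.

Lemma Qstar_bounds s a : 0 <= Qstar P r gamma s a <= H.
Proof.
by have [f [-> _]] := Qstar_optimal; apply: Qpi_bounds; exact: det_policy_is_policy.
Qed.

End Bellman.

(** * Pathwise error bound *)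

Section Dynamics.
Variables (R : realType) (S A : finType) (a0 : A).
Variables (P : S -> A -> S -> R) (r : S -> A -> R) (gamma : R).
Variables (eta : nat -> R) (Q0 : S -> A -> R) (T tau : nat).
Hypothesis kerP : is_kernel P.
Hypothesis r01 : forall s a, 0 <= r s a <= 1.
Hypothesis gamma01 : 0 < gamma < 1.
Hypothesis eta01 : forall t, (t <= T)%N -> 0 <= eta t <= 1.
Hypothesis Q0_bounds : forall s a, 0 <= Q0 s a <= 1 / (1 - gamma).

Local Notation H := (1 / (1 - gamma)).
Local Notation Qt := (Qlearn a0 r gamma eta Q0).
Local Notation Qs := (Qstar P r gamma).

Let kerPd s a : is_dist (P s a).
Proof. by have [] := kerP s a. Qed.

(* [noise] collects the sampling errors made after time [tau]: subtracting it from
   the error leaves a recursion driven by the exact kernel. *)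
Fixpoint noise (smp : nat -> S -> A -> S) (t : nat) (s : S) (a : A) : R :=
  match t with
  | 0 => 0
  | t'.+1 => if (t' < tau)%N then 0 else
      (1 - eta t) * noise smp t' s a
      + eta t * (gamma * (Vmax a0 (Qt smp t') (smp t s a)
                          - mean (P s a) (Vmax a0 (Qt smp t'))))
  end.

(** The weights carry [eta] to the first power, as in the Q-learning recursion, so that this term
    can be carried along in the error invariant. The second factor of a quadratic variation is later
    bounded by a uniform [etab]. *)
Fixpoint noise_var (smp : nat -> S -> A -> S) (t : nat) (s : S) (a : A) : R :=
  match t with
  | 0 => 0
  | t'.+1 => if (t' < tau)%N then 0 else
      (1 - eta t) * noise_var smp t' s a
      + eta t * dvariance (P s a) (Vmax a0 (Qt smp t'))
  end.

Lemma noise_start smp t s a : (t <= tau)%N -> noise smp t s a = 0.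
Proof. by case: t => //= t ->. Qed.

Lemma noise_var_start smp t s a : (t <= tau)%N -> noise_var smp t s a = 0.
Proof. by case: t => //= t ->. Qed.

Lemma noise_var_ge0 smp t s a : (t <= T)%N -> 0 <= noise_var smp t s a.
Proof.
elim: t => [|t IH] tT //=; case: ifP => // _.
have /andP[e0 e1] := eta01 tT.
by rewrite addr_ge0 // mulr_ge0 ?subr_ge0 ?IH ?dvariance_ge0 // ltnW.
Qed.

Lemma eq_Qlearn smp smp' t : (forall k, (0 < k <= t)%N -> smp k = smp' k) ->
  Qt smp t = Qt smp' t.
Proof.
elim: t => [|t IH] // e; apply/funext => s; apply/funext => a /=.
rewrite e ?leqnn // IH // => k /andP[k0 kt].
by apply: e; rewrite k0 leqW.
Qed.

Lemma eq_noise smp smp' t : (forall k, (0 < k <= t)%N -> smp k = smp' k) ->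
  noise smp t = noise smp' t.
Proof.
elim: t => [|t IH] // e; apply/funext => s; apply/funext => a /=.
have e' k : (0 < k <= t)%N -> smp k = smp' k.
  by move=> /andP[k0 kt]; apply: e; rewrite k0 leqW.
by rewrite e ?leqnn // IH // (eq_Qlearn e').
Qed.

(** The strict [k < t] expresses predictability: the variance process at time [t] ignores the sample
    drawn at [t]. *)
Lemma eq_noise_var smp smp' t : (forall k, (0 < k < t)%N -> smp k = smp' k) ->
  noise_var smp t = noise_var smp' t.
Proof.
elim: t => [|t IH] // e; apply/funext => s; apply/funext => a /=.
by rewrite IH ?(@eq_Qlearn smp smp' t) // => k /andP[k0 kt]; apply: e; rewrite k0 ltnW.
Qed.

Lemma Vmax_bounds (Q : S -> A -> R) s :
  (forall s a, 0 <= Q s a <= H) -> 0 <= Vmax a0 Q s <= H.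
Proof. by move=> QH; have [a ->] := Vmax_attained a0 Q s. Qed.

Lemma Qlearn_bounds smp t s a : (t <= T)%N -> 0 <= Qt smp t s a <= H.
Proof.
elim: t s a => [|t IH] s a tT //=.
have /andP[e0 e1] := eta01 tT; have /andP[q0 q1] := IH s a (ltnW tT).
have /andP[v0 v1] : 0 <= Vmax a0 (Qt smp t) (smp t.+1 s a) <= H.
  by apply: Vmax_bounds => s' a'; apply: IH; exact: ltnW.
have /andP[r0 r1] := r01 s a; have /andP[g0 g1] := gamma01.
have hE := horizonE gamma01; move: (H) q1 v1 hE => h.
move: (Vmax _ _ _) v0 (Qt _ _ _ _) q0 => v v0 q q0 q1 v1 hE.
have t0 : 0 <= r s a + gamma * v by rewrite addr_ge0 // mulr_ge0 // ltW.
have t1 : r s a + gamma * v <= h by nra.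
by apply/andP; split; nra.
Qed.

(** The witness is greedy for [Q] when [sg = 1] and for [Q'] when [sg = -1]. In both cases it is
    greedy for [Q'] up to [2 * D], which later allows a potential in [Q'] to be replaced by one in
    [Vmax a0 Q']. *)
Lemma Vmax_diff (Q Q' : S -> A -> R) (D sg : R) s : sg = 1 \/ sg = -1 ->
  (forall a, `|Q s a - Q' s a| <= D) ->
  exists a, sg * (Vmax a0 Q s - Vmax a0 Q' s) <= sg * (Q s a - Q' s a)
    /\ Vmax a0 Q' s - 2 * D <= Q' s a.
Proof.
move=> hsg hD; have [a aE] := Vmax_attained a0 Q s.
have [b bE] := Vmax_attained a0 Q' s.
have := le_Vmax a0 Q s b; have := le_Vmax a0 Q' s a.
have := hD a; have := hD b; rewrite !ler_norml aE bE => /andP[? ?] /andP[? ?] ? ?.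
by case: hsg => ->; [exists a|exists b]; rewrite ?aE ?bE; split; lra.
Qed.

(** Of the initial [2 * H], one [H] covers the error at time [tau] and the other the potential
    [kap * Qs ^+ 2 <= 1]. Only half of the contraction [1 - gamma] is kept as decay rate. *)
Definition transient (t : nat) : R :=
  2 * H * \prod_(tau <= k < t) (1 - eta k.+1 * (1 - gamma) / 2).

Lemma transient_ge0 t : (t <= T)%N -> 0 <= transient t.
Proof.
move=> tT; have h1 := horizon_ge1 gamma01; have /andP[g0 g1] := gamma01.
rewrite mulr_ge0 //; first lra.
rewrite big_seq_cond; apply: prodr_ge0 => k; rewrite mem_index_iota andbT => /andP[_ kt].
have /andP[e0 e1] := eta01 (leq_trans kt tT); nra.
Qed.

Lemma transientS t : (tau <= t)%N ->
  transient t.+1 = transient t * (1 - eta t.+1 * (1 - gamma) / 2).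
Proof. move=> tt; rewrite /transient big_nat_recr //=; ring. Qed.

(** * Drift of the error envelope on the event where the noise is controlled *)

Section Envelope.
Variables (smp : nat -> S -> A -> S) (lam b kap C : R).
(** [kapE] matches the drift of the potential to the factor 2 of [dvariance_perturb]. [small_gain]
    lets the terms proportional to the error use a quarter of the contraction, and [small_bias] fits
    the constant terms into the other three quarters at level [C]. *)
Hypotheses (lam0 : 0 <= lam) (b0 : 0 <= b) (kapE : kap * gamma ^+ 2 = 2 * lam).
Hypothesis small_gain : (4 * kap + 2 * lam) * H <= (1 - gamma) / 4.
Hypothesis small_bias : 2 * kap * H + b <= 3 / 4 * (1 - gamma) * C.
Hypothesis good : forall t, (tau <= t <= T)%N -> forall s a,
  `|noise smp t s a| <= lam * noise_var smp t s a + b.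

Let V t := Vmax a0 (Qt smp t).
Let Vs := Vmax a0 Qs.

Let kap0 : 0 <= kap.
Proof.
have /andP[g0 g1] := gamma01.
have : 0 <= kap * gamma ^+ 2 by rewrite kapE mulr_ge0.
by rewrite pmulr_lge0 // exprn_gt0.
Qed.

(* [- kap * Qs ^+ 2] is the potential whose drift under the Bellman operator pays for
   the variance term [lam * dvariance V] of the noise. *)
Let invariant t := forall (sg : R) s a, sg = 1 \/ sg = -1 ->
  sg * (Qt smp t s a - Qs s a - noise smp t s a)
    <= C + transient t - kap * Qs s a ^+ 2 - (lam * noise_var smp t s a + b).

Let invariant_start : (tau <= T)%N -> invariant tau.
Proof.
move=> tT sg s a hsg; rewrite noise_start // noise_var_start // /transient big_geq //.
have bp := b0; have kapp := kap0; have lamp := lam0.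
have /andP[q0 q1] := Qlearn_bounds smp s a tT.
have /andP[p0 p1] := Qstar_bounds a0 kerP r01 gamma01 s a.
have /andP[g0 g1] := gamma01; have hE := horizonE gamma01.
have h1 := horizon_ge1 gamma01.
move: (H) q1 p1 hE h1 small_gain small_bias => h q1 p1 hE h1 sG sB.
move: (Qt _ _ _ _) (Qs _ _) q0 q1 p0 p1 => q p q0 q1 p0 p1.
have kh : 16 * (kap * h) <= 1 - gamma.
  have : 0 <= lam * h by rewrite mulr_ge0 //; lra.
  by move: sG; rewrite mulrDl => ? ?; lra.
have C0 : 0 <= C.
  have : 0 <= kap * h by rewrite mulr_ge0 //; lra.
  move=> kh0; have : 0 <= (1 - gamma) * C.
    lra.
  by rewrite pmulr_rge0 //; lra.
have bC : b <= C.
  have : 0 <= kap * h by rewrite mulr_ge0 //; lra.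
  move=> ?; have : (1 - gamma) * C <= C by nra.
  by move=> ?; lra.
have kp : kap * p ^+ 2 <= 1.
  have : kap * p ^+ 2 <= kap * h * h.
    by rewrite -mulrA ler_wpM2l // expr2 ler_pM.
  move=> /le_trans; apply; nra.
by case: hsg => ->; lra.
Qed.

(** The slack [lam * noise_var + b] kept in the invariant is exactly what [good] needs to add the
    noise back. *)
Let error_bound t s a (sg : R) : (tau <= t <= T)%N -> invariant t ->
  sg = 1 \/ sg = -1 ->
  sg * (Qt smp t s a - Qs s a) <= C + transient t - kap * Qs s a ^+ 2.
Proof.
move=> tT inv hsg; have := inv sg s a hsg; have := good tT s a.
by rewrite ler_norml => /andP[? ?]; case: hsg => ->; lra.
Qed.

Let error_bound_abs t s a : (tau <= t <= T)%N -> invariant t ->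
  `|Qt smp t s a - Qs s a| <= C + transient t.
Proof.
move=> tT inv; have kq : 0 <= kap * Qs s a ^+ 2 by rewrite mulr_ge0 ?sqr_ge0.
have := error_bound s a tT inv (or_introl erefl).
have := error_bound s a tT inv (or_intror erefl).
by rewrite ler_norml => ? ?; apply/andP; split; lra.
Qed.

(** With [D = C + transient t], the chosen action loses at most [2 * D] in [Qs], so
    [Vs ^+ 2 - Qs ^+ 2 <= 2 * D * (2 * H)]; this is the price of moving the potential to [Vs]. *)
Let value_error t s (sg : R) : (tau <= t <= T)%N -> invariant t ->
  sg = 1 \/ sg = -1 ->
  sg * (V t s - Vs s) <= C + transient t - kap * Vs s ^+ 2
                         + 4 * kap * H * (C + transient t).
Proof.
move=> tT inv hsg.
have [a [leQ geQ]] := Vmax_diff hsg (fun a => error_bound_abs s a tT inv).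
apply: (le_trans leQ); apply: (le_trans (error_bound s a tT inv hsg)).
have D0 : 0 <= C + transient t := le_trans (normr_ge0 _) (error_bound_abs s a tT inv).
have /andP[p0 p1] := Qstar_bounds a0 kerP r01 gamma01 s a.
have /andP[v0 v1] : 0 <= Vs s <= H.
  by apply: Vmax_bounds => s' a'; exact: (Qstar_bounds a0).
have pv : Qs s a <= Vs s := le_Vmax a0 Qs s a.
move: geQ; rewrite -/(Vs s); move: (Vs s) (Qs s a) v0 v1 p0 p1 pv => v q v0 v1 q0 q1 qv geQ.
move: (C + _) geQ D0 => D geQ D0; move: (H) v1 q1 => h v1 q1.
have : kap * (v ^+ 2 - q ^+ 2) <= kap * (4 * h * D).
  apply: ler_wpM2l => //; rewrite subr_sqr.
  have -> : 4 * h * D = 2 * D * (2 * h) by ring.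
  by apply: ler_pM; lra.
by rewrite mulrBr => ?; lra.
Qed.

(** The value error is below both [D] and [H], so its square is below [H * D]. Being linear in the
    error, this term can be absorbed by the contraction. *)
Let variance_error t s a : (tau <= t <= T)%N -> invariant t ->
  dvariance (P s a) (V t) <= 2 * dvariance (P s a) Vs + 2 * (H * (C + transient t)).
Proof.
move=> tT inv; set D := C + _.
have D0 : 0 <= D := le_trans (normr_ge0 _) (error_bound_abs s a tT inv).
have h1 := horizon_ge1 gamma01.
have vD s' : `|V t s' - Vs s'| <= Num.min D H.
  rewrite le_min; apply/andP; split.
    rewrite ler_norml -/D; apply/andP; split.
      have [c [+ _]] := Vmax_diff (or_intror erefl) (fun a => error_bound_abs s' a tT inv).
      have := error_bound_abs s' c tT inv; rewrite ler_norml -/D -/(V t) -/Vs.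
      by move=> /andP[? ?] ?; lra.
    have [c [+ _]] := Vmax_diff (or_introl erefl) (fun a => error_bound_abs s' a tT inv).
    have := error_bound_abs s' c tT inv; rewrite ler_norml -/D -/(V t) -/Vs.
    by move=> /andP[? ?] ?; lra.
  have /andP[v0 v1] : 0 <= Vs s' <= H.
    by apply: Vmax_bounds => ? ?; exact: (Qstar_bounds a0).
  have /andP[w0 w1] : 0 <= V t s' <= H.
    by apply: Vmax_bounds => ? ?; apply: Qlearn_bounds; case/andP: tT.
  by rewrite ler_norml; apply/andP; split; lra.
apply: (le_trans (dvariance_perturb (kerPd s a) vD)).
rewrite lerD2l ler_pM2l // expr2 mulrC.
have m0 : 0 <= Num.min D H by rewrite le_min D0; lra.
by apply: ler_pM; rewrite // ge_min lexx ?orbT.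
Qed.

Let invariant_step t : (tau <= t)%N -> (t < T)%N -> invariant t -> invariant t.+1.
Proof.
move=> tt tT inv sg s a hsg.
have tT' : (tau <= t <= T)%N by rewrite tt ltnW.
have vars := variance_error s a tT' inv.
have means : sg * (mean (P s a) (V t) - mean (P s a) Vs) <=
    (C + transient t + 4 * kap * H * (C + transient t))
    - kap * mean (P s a) (fun s' => Vs s' ^+ 2).
  have [p0 p1] := kerPd s a.
  have -> : sg * (mean (P s a) (V t) - mean (P s a) Vs)
      = mean (P s a) (fun s' => sg * (V t s' - Vs s')).
    rewrite -meanB /mean mulr_sumr; apply: eq_bigr => s' _; ring.
  apply: le_trans (mean_le (kerPd s a) (fun s' => value_error s' tT' inv hsg)) _.
  rewrite le_eqVlt; apply/orP; left; apply/eqP.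
  set c := 4 * _ * _ * _; set d := C + _.
  rewrite (@eq_mean _ _ _ _ (fun s' => (- kap) * Vs s' ^+ 2 + (d + c) * 1)); last first.
    by move=> s'; ring.
  rewrite mean_lin mean_cst //; ring.
have D0 : 0 <= C + transient t := le_trans (normr_ge0 _) (error_bound_abs s a tT' inv).
have G0 := transient_ge0 (ltnW tT).
have prev := inv sg s a hsg.
have qE := Qstar_bellman a0 kerP r01 gamma01 s a.
have /andP[q0 q1] := Qstar_bounds a0 kerP r01 gamma01 s a.
have /andP[r0 r1] := r01 s a; have /andP[g0 g1] := gamma01.
have /andP[e0 e1] := eta01 tT; have h1 := horizon_ge1 gamma01.
have hE := horizonE gamma01.
have M0 : 0 <= mean (P s a) (fun s' => Vs s' ^+ 2).
  by apply: mean_ge_cst => // s'; exact: sqr_ge0.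
move: vars; rewrite (dvarianceE Vs) // => vars.
rewrite transientS //= ltnNge tt /= -/(V t) -/Vs.
move: vars means prev qE; rewrite -/Vs.
move: (dvariance _ _) (V t (smp _ _ _)) (mean (P s a) (V t)) (mean (P s a) Vs) => W v mv m.
move: (mean _ _) M0 (Qs s a) q0 q1 (r s a) r0 r1 => M M0 q q0 q1 rr r0 r1.
move: (Qt _ _ _ _) (noise _ _ _ _) (noise_var _ _ _ _) => x n nv.
move: (transient t) G0 D0 (eta t.+1) e0 e1 => G G0 D0 e e0 e1.
move: small_gain small_bias; move: (H) q1 h1 hE => h q1 h1 hE sG sB vars means prev qE.
set D := C + G in vars means D0.
(* Drift of the noise-free error under the exact kernel, with the variance of the current value
   included. *)
have drift : gamma * (sg * (mv - m)) + (lam * W + b)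
    <= C + G - kap * q ^+ 2 - (1 - gamma) / 2 * G.
  have i1 : gamma * (sg * (mv - m)) <= gamma * (D + 4 * kap * h * D - kap * M).
    by rewrite ler_pM2l.
  have i2 : lam * W <= lam * (2 * (M - m ^+ 2) + 2 * (h * D)) by rewrite ler_wpM2l.
  (* With [i7] this says [2 * lam * (M - m ^+ 2) - gamma * kap * M <= - kap * q ^+ 2 + 2 * kap * h]:
     the potential pays for the variance of [Vs]. The bracket is nonnegative because [q <= h] and
     [rr <= 1]. *)
  have i3 : 0 <= kap * (gamma * (1 - gamma) * M + rr ^+ 2 + 2 * (h - q * rr)).
    rewrite mulr_ge0 // !addr_ge0 ?sqr_ge0 //.
      by rewrite mulr_ge0 // mulr_ge0 //; lra.
    rewrite mulr_ge0 // subr_ge0; apply: le_trans q1; rewrite -[leRHS]mulr1.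
    exact: ler_wpM2l.
  have i4 : gamma * (4 * kap * h * D) <= 4 * kap * h * D.
    rewrite -[leRHS]mul1r; apply: ler_wpM2r; last exact: ltW.
    by rewrite !mulr_ge0 //; lra.
  have i5 : (4 * kap + 2 * lam) * h * D <= (1 - gamma) / 4 * D by rewrite ler_wpM2r.
  have i6 : (gamma * m) ^+ 2 = (q - rr) ^+ 2 by rewrite qE; congr (_ ^+ 2); ring.
  have i7 : 2 * lam * (M - m ^+ 2) = kap * (gamma ^+ 2 * M - (q - rr) ^+ 2).
    by rewrite -kapE -i6; ring.
  have e1' : gamma * (D + 4 * kap * h * D - kap * M)
    = gamma * D + gamma * (4 * kap * h * D) - gamma * (kap * M) by ring.
  have e2 : lam * (2 * (M - m ^+ 2) + 2 * (h * D))
    = 2 * lam * (M - m ^+ 2) + 2 * lam * h * D by ring.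
  have e3 : (4 * kap + 2 * lam) * h * D = 4 * kap * h * D + 2 * lam * h * D by ring.
  have e4 : kap * (gamma * (1 - gamma) * M + rr ^+ 2 + 2 * (h - q * rr))
    = gamma * (kap * M) - kap * (gamma ^+ 2 * M - (q - rr) ^+ 2) - kap * q ^+ 2
      + 2 * kap * h by ring.
  have e5 : (1 - gamma) / 4 * D = (1 - gamma) * D - 3 / 4 * (1 - gamma) * C
     - 3 / 4 * ((1 - gamma) * G) by rewrite /D; field.
  have e6 : (1 - gamma) / 2 * G = (1 - gamma) * G / 2 by ring.
  have i8 : 0 <= (1 - gamma) * G by rewrite mulr_ge0 //; lra.
  have e7 : (1 - gamma) * D = D - gamma * D by ring.
  rewrite e6 -/D; lra.
(* Subtracting the noise cancels the sampled value [v] and leaves its mean [mv]; the Bellman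
   equation then removes the reward. *)
have -> : sg * ((1 - e) * x + e * (rr + gamma * v) - q -
       ((1 - e) * n + e * (gamma * (v - mv))))
   = (1 - e) * (sg * (x - q - n)) + e * (gamma * (sg * (mv - m))).
  by rewrite [in LHS]qE [in RHS]qE; ring.
have j1 : (1 - e) * (sg * (x - q - n)) <= (1 - e) * (C + G - kap * q ^+ 2 - (lam * nv + b)).
  by apply: ler_wpM2l => //; lra.
have j2 := ler_wpM2l e0 drift.
have e1' : e * (gamma * (sg * (mv - m)) + (lam * W + b)) =
  e * (gamma * (sg * (mv - m))) + e * (lam * W + b) by ring.
have e2 : (1 - e) * (C + G - kap * q ^+ 2 - (lam * nv + b))
   + e * (C + G - kap * q ^+ 2 - (1 - gamma) / 2 * G) - e * (lam * W + b)
   = C + G * (1 - e * (1 - gamma) / 2) - kap * q ^+ 2 -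
   (lam * ((1 - e) * nv + e * W) + b) by ring.
lra.
Qed.

Lemma error_envelope t s a : (tau <= t <= T)%N ->
  `|Qt smp t s a - Qs s a| <= C + transient t.
Proof.
move=> tT; apply: error_bound_abs => //.
case/andP: tT; elim: t => [|t IH].
  by rewrite leqn0 => /eqP t0 _; rewrite -[X in invariant X]t0;
    apply: invariant_start; rewrite t0.
rewrite leq_eqVlt => /orP[/eqP <-|]; first exact: invariant_start.
by move=> tt tT; apply: invariant_step => //; apply: IH => //; exact: ltnW.
Qed.

End Envelope.

End Dynamics.

(** * Concentration of the noise *)

Section Concentration.
Variables (R : realType) (S A : finType) (a0 : A).
Variables (P : S -> A -> S -> R) (r : S -> A -> R) (gamma : R).
Variables (eta : nat -> R) (Q0 : S -> A -> R) (T tau : nat) (etab : R).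
Hypothesis kerP : is_kernel P.
Hypothesis r01 : forall s a, 0 <= r s a <= 1.
Hypothesis gamma01 : 0 < gamma < 1.
Hypothesis eta01 : forall t, (t <= T)%N -> 0 <= eta t <= 1.
Hypothesis Q0_bounds : forall s a, 0 <= Q0 s a <= 1 / (1 - gamma).
Hypothesis eta_le : forall t, (tau < t <= T)%N -> eta t <= etab.

Local Notation H := (1 / (1 - gamma)).
Local Notation Qt := (Qlearn a0 r gamma eta Q0).
Local Notation noise := (noise a0 P r gamma eta Q0 tau).
Local Notation noise_var := (noise_var a0 P r gamma eta Q0 tau).

(** With this choice [product_law p] unfolds to [path_prob P]. *)
Let p (x : 'I_T * S * A) := P x.1.2 x.2.

Let dp x : is_dist (p x).
Proof. by have [] := kerP x.1.2 x.2. Qed.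

Let dlaw : is_dist (product_law p).
Proof. by split; [exact: product_law_ge0 | exact: product_law_sum1]. Qed.

Lemma sample_of_update_now (w : sample_space S A T) (t : nat) (tT : (t < T)%N) s a y :
  sample_of (update w (Ordinal tT, s, a) y) t.+1 s a = y.
Proof. by rewrite /sample_of /= insubT /= ffunE eqxx. Qed.

(** Coordinate [t] of a path holds the sample of time [t.+1], so changing it leaves all times up to
    [t] untouched. *)
Lemma sample_of_update_past (w : sample_space S A T) (t : nat) (tT : (t < T)%N) s a y k :
  (0 < k <= t)%N -> sample_of (update w (Ordinal tT, s, a) y) k = sample_of w k.
Proof.
move=> /andP[k0 kt]; apply/funext => s'; apply/funext => a'.
rewrite /sample_of; case: insubP => // i _ iE; rewrite ffunE.
case: eqP => // -[it _ _]; have tE : t = k.-1 by rewrite -iE it.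
by exfalso; move: kt; rewrite tE leqNgt ltn_predL k0.
Qed.

(** Induction with [theta] varying: averaging over the newest sample leaves the noise of time [t]
    multiplied by [1 - e], that is, the claim at parameter [theta * (1 - e)]. *)
Lemma noise_mgf (theta sg : R) t s a : 0 <= theta -> theta * etab * H <= 1 / 2 ->
  sg = 1 \/ sg = -1 -> (t <= T)%N ->
  mean (product_law p) (fun w : sample_space S A T => expR (theta * (sg * noise (sample_of w) t s a)
    - 2 * theta ^+ 2 * etab * noise_var (sample_of w) t s a)) <= 1.
Proof.
move=> + + hsg; elim: t theta => [|t IH] theta th0 thH tT /=.
  by apply: mean_le_cst => // w; rewrite !mulr0 subr0 expR0.
case: ltnP => tt; first by apply: mean_le_cst => // w; rewrite !mulr0 subr0 expR0.
have /andP[e0 e1] := eta01 tT; have eb : eta t.+1 <= etab by apply: eta_le; rewrite ltnS tt.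
have h1 := horizon_ge1 gamma01; have /andP[g0 g1] := gamma01.
move: (eta t.+1) e0 e1 eb => e e0 e1 eb.
have th'0 : 0 <= theta * (1 - e) by rewrite mulr_ge0 // subr_ge0.
have th'H : theta * (1 - e) * etab * H <= 1 / 2.
  apply: le_trans thH; rewrite -!mulrA ler_wpM2l // ler_piMl //; last by lra.
  by rewrite mulr_ge0 ?(le_trans e0 eb) //; lra.
(* Resampling this one coordinate plays the role of conditioning on the past. *)
apply: le_trans (IH _ th'0 th'H (ltnW tT)); rewrite (resample dp (Ordinal tT, s, a)).
apply: mean_le => // w; rewrite /p /=.
have dP : is_dist (P s a) by have [] := kerP s a.
have past y k : (0 < k <= t)%N -> sample_of (update w (Ordinal tT, s, a) y) k = sample_of w k.
  exact: sample_of_update_past.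
set V := Vmax a0 (Qt (sample_of w) t).
have V_bounds y : 0 <= V y <= H.
  apply: Vmax_bounds => s' a'; apply: (Qlearn_bounds a0 r01 gamma01 eta01 Q0_bounds).
  exact: ltnW.
have nv0 : 0 <= noise_var (sample_of w) t s a by apply: (noise_var_ge0 _ _ _ _ _ kerP eta01); exact: ltnW.
move N_def : (noise (sample_of w) t s a) => N.
move nv_def : (noise_var (sample_of w) t s a) nv0 => nv nv0.
set W := dvariance (P s a) V.
pose u := theta * sg * e * gamma.
rewrite (@eq_mean _ _ _ _ (fun y => expR (theta * (1 - e) * (sg * N)
     - 2 * theta ^+ 2 * etab * ((1 - e) * nv + e * W))
   * expR (u * (V y - mean (P s a) V)))); last first.
  move=> y /=; rewrite -expRD; congr expR.
  rewrite sample_of_update_now (eq_noise _ _ _ _ _ _ _ (past y)) (eq_Qlearn _ _ _ _ _ (past y)).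
  rewrite (@eq_noise_var _ _ _ _ _ _ _ _ _ _ _ (sample_of w)); last first.
    by move=> k /andP[k0 kt]; apply: past; rewrite k0 ltnW.
  by rewrite N_def nv_def -/V -/W /u; ring.
rewrite /mean; under eq_bigr do rewrite mulrCA; rewrite -mulr_sumr -/(mean _ _).
have W0 : 0 <= W := dvariance_ge0 _ dP.
have sg2 : sg ^+ 2 = 1 by case: hsg => ->; rewrite ?sqrrN expr1n.
have u_small y : `|u * (V y - mean (P s a) V)| <= 1 / 2.
  apply: le_trans thH; rewrite normrM; apply: ler_pM => //.
    have sgn : `|sg| = 1 by case: hsg => ->; rewrite ?normrN normr1.
    rewrite /u !normrM sgn mulr1 (ger0_norm th0) (ger0_norm e0) (gtr0_norm g0).
    by rewrite -mulrA ler_wpM2l //; apply: le_trans eb; rewrite ler_piMr // ltW.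
  have m0 : 0 <= mean (P s a) V by apply: mean_ge_cst => // z; have /andP[] := V_bounds z.
  have m1 : mean (P s a) V <= H by apply: mean_le_cst => // z; have /andP[] := V_bounds z.
  by have /andP[v0 v1] := V_bounds y; rewrite ler_norml; apply/andP; split; lra.
apply: le_trans (ler_wpM2l (expR_ge0 _) (mgf_le_dvariance dP u_small)) _.
rewrite -expRD ler_expR -/W.
(* One factor [e] is traded for [etab], so the newest term of the compensator pays for the new
   variance. In [i2], [(1 - e) ^+ 2 <= 1 - e] does the same for the older terms. *)
have u2 : u ^+ 2 <= theta ^+ 2 * etab * e.
  have -> : u ^+ 2 = theta ^+ 2 * (e * (e * gamma ^+ 2)) by rewrite /u !exprMn sg2; ring.
  rewrite -mulrA ler_wpM2l ?sqr_ge0 // [etab * e]mulrC ler_wpM2l //.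
  by apply: le_trans eb; rewrite ler_piMr // expr_le1 // ltW.
have i1 : u ^+ 2 * W <= theta ^+ 2 * etab * e * W by rewrite ler_wpM2r.
have i2 : (theta * (1 - e)) ^+ 2 * etab * nv <= theta ^+ 2 * (1 - e) * etab * nv.
  rewrite exprMn !ler_wpM2r ?(le_trans e0 eb) // ler_wpM2l ?sqr_ge0 //.
  by rewrite expr2 ler_piMl ?subr_ge0 //; lra.
have e2 : 2 * theta ^+ 2 * etab * ((1 - e) * nv + e * W)
  = 2 * (theta ^+ 2 * (1 - e) * etab * nv) + 2 * (theta ^+ 2 * etab * e * W) by ring.
have e3 : 2 * u ^+ 2 * W = 2 * (u ^+ 2 * W) by ring.
have e4 : 2 * (theta * (1 - e)) ^+ 2 * etab * nv
  = 2 * ((theta * (1 - e)) ^+ 2 * etab * nv) by ring.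
lra.
Qed.

(** Chernoff bound from [noise_mgf] and a union bound over times, state-action pairs and both signs;
    the signs give the factor 2. *)
Lemma prob_event_noise (theta L : R) (E : pred (sample_space S A T)) :
  0 < theta -> theta * etab * H <= 1 / 2 -> 0 <= L ->
  (forall w, (forall t, (tau <= t <= T)%N -> forall s a,
     `|noise (sample_of w) t s a|
       <= 2 * theta * etab * noise_var (sample_of w) t s a + L / theta) -> E w) ->
  1 - 2 * (#|S|%:R * #|A|%:R * T%:R) * expR (- L) <= prob_event P E.
Proof.
move=> th0 thH L0 goodE; pose sg (c : bool) : R := if c then 1 else -1.
have hsg c : sg c = 1 \/ sg c = -1 by case: c; [left|right].
(* [L < F z w] is the failure of one one-sided bound, divided by [theta]. Index [i] stands for time
   [i.+1]; at time 0 the noise vanishes. The indicator of failure is then dominated by the sum of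
   [expR (F z w - L)]. *)
pose F (z : 'I_T * S * A * bool) (w : sample_space S A T) :=
  theta * (sg z.2 * noise (sample_of w) z.1.1.1.+1 z.1.1.2 z.1.2)
    - 2 * theta ^+ 2 * etab * noise_var (sample_of w) z.1.1.1.+1 z.1.1.2 z.1.2.
have -> : prob_event P E = mean (product_law p) (fun w => (E w)%:R).
  rewrite /prob_event /mean big_mkcond /=; apply: eq_bigr => w _.
  by case: (E w); rewrite ?mulr1 ?mulr0.
rewrite lerBlDl -lerBlDr -{1}(mean_cst 1 dlaw) -meanB.
apply: (@le_trans _ _ (mean (product_law p)
    (fun w => \sum_z expR (- L) * expR (F z w)))).
  apply: mean_le => // w; case Ew : (E w).
    by rewrite subrr sumr_ge0 // => z _; rewrite mulr_ge0 ?expR_ge0.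
  have [z zL] : exists z, L < F z w.
    apply/not_existsP => noz; suff: E w by rewrite Ew.
    apply: goodE => -[_ s a|t /andP[_ tT] s a].
      by rewrite /= normr0 mulr0 add0r divr_ge0 // ltW.
    have /negP := noz (Ordinal tT, s, a, true); have /negP := noz (Ordinal tT, s, a, false).
    rewrite -!leNgt /F [sg true]/= [sg false]/=.
    move: (noise _ t.+1 s a) (noise_var _ t.+1 s a) => /= N nv lo hi.
    rewrite ler_norml -(ler_pM2l th0) -[X in _ && X](ler_pM2l th0).
    have -> : theta * (2 * theta * etab * nv + L / theta) = 2 * theta ^+ 2 * etab * nv + L.
      by field; exact: lt0r_neq0.
    have -> : theta * - (2 * theta * etab * nv + L / theta)
        = - (2 * theta ^+ 2 * etab * nv + L).
      by field; exact: lt0r_neq0.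
    by apply/andP; split; lra.
  rewrite subr0 (bigD1 z) //=; apply: (@le_trans _ _ (expR (- L) * expR (F z w))).
    by rewrite -expRD -expR0 ler_expR; lra.
  by rewrite lerDl sumr_ge0 // => z' _; rewrite mulr_ge0 ?expR_ge0.
rewrite /mean; under eq_bigr do rewrite mulr_sumr; rewrite exchange_big /=.
apply: (@le_trans _ _ (\sum_(z : 'I_T * S * A * bool) expR (- L))).
  apply: ler_sum => z _; under eq_bigr do rewrite mulrCA; rewrite -mulr_sumr.
  rewrite -[leRHS]mulr1 ler_wpM2l ?expR_ge0 //.
  by apply: noise_mgf; [exact: ltW | exact: thH | exact: hsg | exact: ltn_ord].
rewrite sumr_const !card_prod card_ord card_bool -[leLHS]mulr_natl !natrM.
by rewrite le_eqVlt; apply/orP; left; apply/eqP; ring.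
Qed.

End Concentration.

(** * Elementary bounds on the logarithm, the half-time window and the transient *)

Section StepSizes.
Variable R : realType.

Lemma ln_nat_ge_half (T : nat) : (1 < T)%N -> 1 / 2 <= ln (T%:R : R).
Proof.
move=> T1; have T0 : 0 < T%:R :> R by rewrite ltr0n ltnW.
rewrite -ler_expR lnK ?posrE //; apply: le_trans (expR_le_quadratic (lexx _)) _.
have : 2 <= T%:R :> R by rewrite ler_nat.
by move=> ?; apply: le_trans (_ : 2 <= _) => //; rewrite expr2; lra.
Qed.

Lemma half_le_tail (T t : nat) : (T./2 < t)%N -> T%:R / 2 <= t%:R :> R.
Proof. by move=> tT; rewrite ler_pdivrMr // -natrM ler_nat; lia. Qed.

Lemma half_le_window (T : nat) : T%:R / 2 <= (T - T./2)%:R :> R.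
Proof. by rewrite ler_pdivrMr // -natrM ler_nat; lia. Qed.

(** Each factor is bounded by [1 - x <= expR (- x)] at the smallest step size. *)
Lemma transient_le (gamma emin : R) (eta : nat -> R) (T tau : nat) :
  0 < gamma < 1 -> (forall t, (t <= T)%N -> 0 <= eta t <= 1) ->
  (forall t, (t <= T)%N -> emin <= eta t) -> (tau <= T)%N ->
  transient gamma eta tau T
    <= 2 / (1 - gamma) * expR (- (emin * (1 - gamma) / 2 * (T - tau)%:R)).
Proof.
move=> /andP[g0 g1] eta01 etam tT.
have -> : 2 / (1 - gamma) = 2 * (1 / (1 - gamma)) by rewrite mul1r.
rewrite /transient ler_wpM2l //; first by rewrite mulr_ge0 // divr_ge0 //; lra.
rewrite -mulNr expRM_natr -prodr_const_nat.
rewrite big_seq [leRHS]big_seq; apply: ler_prod => k.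
rewrite mem_index_iota => /andP[_ kT]; have /andP[e0 e1] := eta01 k.+1 kT.
have em := etam k.+1 kT; apply/andP; split; first by nra.
apply: le_trans (expR_ge1Dx _).
have : emin * (1 - gamma) <= eta k.+1 * (1 - gamma) by rewrite ler_pM2r //; lra.
by move=> ?; lra.
Qed.

End StepSizes.

(** * Choice of the constants and proof of the sample complexity bound *)

Lemma prob_event_true (R : realType) (S A : finType) (P : S -> A -> S -> R) (T : nat)
    (E : pred (sample_space S A T)) :
  is_kernel P -> (forall w, E w) -> prob_event P E = 1.
Proof.
move=> kerP allE; rewrite /prob_event (eq_bigl xpredT) => [|w]; last exact: allE.
by apply: (@product_law_sum1 _ _ _ (fun x : 'I_T * S * A => P x.1.2 x.2)) => x; exact: kerP.
Qed.

Lemma le_sup_err (R : realType) (S A : finType) (Q Q' : S -> A -> R) (x : R) :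
  0 <= x -> (forall s a, `|Q s a - Q' s a| <= x) -> sup_err Q Q' <= x.
Proof. by move=> x0 h; apply: bigmax_le => // -[s a] _; exact: h. Qed.

Theorem mainTheorem4 (R : realType) :
  exists c0 : R, 0 < c0 /\
  forall c1 c2 : R, 0 < c2 -> c2 <= c1 -> c1 <= c0 ->
  exists c3 : R, 0 < c3 /\
  forall (S A : finType) (a0 : A) (P : S -> A -> S -> R) (r : S -> A -> R)
         (gamma delta eps : R) (T : nat) (eta : nat -> R) (Q0 : S -> A -> R),
    is_kernel P ->
    (forall s a, 0 <= r s a <= 1) ->
    0 < delta < 1 ->
    0 < gamma < 1 ->
    0 < eps <= 1 / (1 - gamma) ->
    (1 < T)%N ->
    (forall t : nat, (t <= T)%N ->
       1 / (1 + c1 * (1 - gamma) * T%:R / (ln (T%:R : R)) ^+ 3) <= eta t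
       <= 1 / (1 + c2 * (1 - gamma) * t%:R / (ln (T%:R : R)) ^+ 3)) ->
    c3 * (ln (T%:R : R)) ^+ 4 * ln (#|S|%:R * #|A|%:R * T%:R / delta)
      / (gamma ^+ 2 * (1 - gamma) ^+ 4 * Num.min (eps ^+ 2) eps) <= T%:R ->
    (forall s a, 0 <= Q0 s a <= 1 / (1 - gamma)) ->
    1 - delta <=
      prob_event P
        (fun w : sample_space S A T =>
           sup_err (Qlearn a0 r gamma eta Q0 (sample_of w) T)
                   (Qstar P r gamma) <= eps).
Proof.
(* [1 / 32] is [1 / 8] times the bound [1 / 4 <= k ^+ 2] for [k = ln T]; it keeps the step sizes
   large enough for the transient to die out. *)
exists (1 / 32); split=> // c1 c2 c2_gt0 c21 c1_le.
have ic2 : 0 < c2^-1 by rewrite invr_gt0.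
(* The first summand, [160 * 4 * 4 / c2], serves the bound on [b]; the second, [8 * 16], yields
   [8 * k] from [k / 16 <= k ^+ 4 * L0]. *)
exists (40 * 64 / c2 + 128); split; first by lra.
move=> S A a0 P r gamma delta eps T eta Q0 kerP r01 /andP[d0 d1] gamma01 /andP[eps0 epsH]
  T1 eta_bounds T_large Q0_bounds.
(* For empty [S] the error is an empty maximum, so the event is sure; otherwise the cardinalities
   are at least 1. *)
have [s0 _|S0] := pickP (fun _ : S => true); last first.
  rewrite (prob_event_true (E := fun w => _)) //; first lra.
  by move=> w; apply: le_sup_err => [|s]; [exact: ltW | have := S0 s].
have /andP[g0 g1] := gamma01; have h1 := horizon_ge1 gamma01; have hE := horizonE gamma01.
set k := ln (T%:R : R) in eta_bounds T_large.
have k_ge : 1 / 2 <= k := ln_nat_ge_half R T1.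
set N : R := T%:R in eta_bounds T_large *.
have N_ge2 : 2 <= N by rewrite ler_nat.
set L0 := ln _ in T_large.
have gp : 0 < 1 - gamma by lra.
have N0 : 0 < N by lra.
have k0 : 0 < k by lra.
have card_ge : 2 <= #|S|%:R * #|A|%:R * N / delta.
  have cS : 1 <= #|S|%:R :> R by rewrite ler1n; apply/card_gt0P; exists s0.
  have cA : 1 <= #|A|%:R :> R by rewrite ler1n; apply/card_gt0P; exists a0.
  have cSA : 1 <= #|S|%:R * #|A|%:R :> R by rewrite -[leLHS]mulr1 ler_pM.
  have : 1 * 2 <= #|S|%:R * #|A|%:R * N :> R by rewrite ler_pM.
  by rewrite ler_pdivlMr // => ?; nra.
have ln2_le : ln 2 <= L0 by rewrite ler_ln ?posrE //; apply: lt_le_trans card_ge.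
have ln2_ge : 1 / 2 <= ln (2 : R) := ln_nat_ge_half R (isT : (1 < 2)%N).
(* The extra [ln 2] absorbs the two signs, making the failure probability exactly [delta]; [ln2_le]
   keeps [L <= 2 * L0]. *)
pose L := L0 + ln 2.
have expL : 2 * (#|S|%:R * #|A|%:R * N) * expR (- L) = delta.
  have p0 : 0 < #|S|%:R * #|A|%:R * N / delta by apply: lt_le_trans card_ge.
  rewrite expRN /L expRD !lnK ?posrE //.
  have : #|S|%:R * #|A|%:R * N != 0.
    by apply: contraTneq p0 => ->; rewrite mul0r ltxx.
  move: (#|S|%:R * #|A|%:R * N) => M M0; field.
  by rewrite M0 lt0r_neq0.
pose mn := Num.min 1 eps.
have mn0 : 0 < mn by rewrite lt_min ltr01.
have mn1 : mn <= 1 by rewrite ge_min lexx.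
have mn_eps : mn <= eps by rewrite ge_min lexx orbT.
have minE : Num.min (eps ^+ 2) eps = mn * eps.
  by rewrite /mn minr_pMl ?(ltW eps0) // mul1r -expr2 minC.
have G4 : 0 < gamma ^+ 2 * (1 - gamma) ^+ 4 * (mn * eps).
  by rewrite !mulr_gt0 ?exprn_gt0.
move: T_large; rewrite minE ler_pdivrMr // => T_large.
have gap_eps : (1 - gamma) * eps <= 1.
  by rewrite -[leRHS]hE ler_pM2l.
have k4 : k / 8 <= k ^+ 4.
  have : (1 / 2) ^+ 3 <= k ^+ 3 by rewrite lerXn2r ?nnegrE // ltW.
  by rewrite [k ^+ 4]exprS => ?; nra.
have kL : k ^+ 4 * L0 * (40 * 64 / c2 + 128) <= N * ((1 - gamma) * (mn * eps) * (gamma ^+ 2 * (1 - gamma) ^+ 3)).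
  apply: le_trans (le_trans T_large _); rewrite le_eqVlt; apply/orP; left; apply/eqP; ring.
have L00 : 0 <= L0 by lra.
have kL0 : 0 <= k ^+ 4 * L0 by rewrite mulr_ge0 // exprn_ge0 // ltW.
have gp1 : 1 - gamma <= 1 by rewrite lerBlDr lerDl ltW.
have gg_le1 n : gamma ^+ 2 * (1 - gamma) ^+ n <= 1.
  by rewrite -[leRHS]mulr1 ler_pM ?exprn_ge0 ?exprn_ile1 // ltW.
have gg0 n : 0 < gamma ^+ 2 * (1 - gamma) ^+ n by rewrite mulr_gt0 ?exprn_gt0.
have k_small : 8 * k <= k ^+ 4 * L0 * (40 * 64 / c2 + 128).
  have i1 : k ^+ 4 * L0 * 128 <= k ^+ 4 * L0 * (40 * 64 / c2 + 128).
    by apply: ler_wpM2l => //; lra.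
  have L0_ge : 1 / 2 <= L0 := le_trans ln2_ge ln2_le.
  have k8 : 0 <= k / 8 by rewrite divr_ge0 // ltW.
  have i3 : k / 8 * (1 / 2) <= k ^+ 4 * L0 by apply: ler_pM => //; rewrite divr_ge0.
  move: i1 i3; clear; move=> *; lra.
have time_large : 8 * k <= N * ((1 - gamma) * eps).
  apply: (le_trans k_small); apply: (le_trans kL); apply: ler_wpM2l; first exact: ltW.
  rewrite -[leRHS]mulr1; apply: ler_pM => //; last 1 first.
  - by apply: ler_wpM2l; [exact: ltW|rewrite ler_piMl // ltW].
  - by rewrite mulr_ge0 ?(ltW gp) // mulr_ge0 // ltW.
  - exact: ltW.
(* When [eps] exceeds 1 this does not follow from [time_large]; here [(1 - gamma) * eps <= 1]
   removes [eps]. *)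
have time_large1 : 8 * k <= N * (1 - gamma).
  apply: (le_trans k_small); apply: (le_trans kL); apply: ler_wpM2l; first exact: ltW.
  have -> : (1 - gamma) * (mn * eps) * (gamma ^+ 2 * (1 - gamma) ^+ 3)
    = (1 - gamma) * (mn * ((1 - gamma) * eps) * (gamma ^+ 2 * (1 - gamma) ^+ 2)) by ring.
  rewrite -[leRHS]mulr1; apply: ler_wpM2l; first exact: ltW.
  have u0 : 0 <= (1 - gamma) * eps by rewrite mulr_ge0 // ltW.
  have v0 : 0 <= gamma ^+ 2 * (1 - gamma) ^+ 2 := ltW (gg0 2%N).
  rewrite -[leRHS]mulr1; apply: ler_pM => //; first by rewrite mulr_ge0 // ltW.
  by rewrite -[leRHS]mulr1; apply: ler_pM => //; exact: ltW.
have time_large2 : 4 <= N * ((1 - gamma) * eps).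
  by apply: le_trans time_large; move: k_ge; clear; move=> *; lra.
have k3 : 0 < k ^+ 3 by rewrite exprn_gt0.
(* [etab] bounds the step sizes after half time. The [20] in [kap] makes [small_gain] hold through
   [(4 + gamma ^+ 2) / 20 <= 1 / 4]; [kapE] then fixes [lam], and [theta] makes the slope
   [2 * theta * etab] of the noise bound equal to [lam]. *)
pose etab := 2 * k ^+ 3 / (c2 * (1 - gamma) * N).
pose lam := gamma ^+ 2 * (1 - gamma) ^+ 2 * mn / 40.
pose kap := (1 - gamma) ^+ 2 * mn / 20.
pose theta := lam / (2 * etab).
pose b := L / theta.
have cgN0 : 0 < c2 * (1 - gamma) * N by rewrite !mulr_gt0.
have etab0 : 0 < etab by rewrite divr_gt0 // mulr_gt0.
have lam0 : 0 < lam by rewrite divr_gt0 // mulr_gt0.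
have theta0 : 0 < theta by rewrite divr_gt0 // mulr_gt0.
have L_ge0 : 0 <= L.
  by rewrite addr_ge0 // (le_trans _ ln2_ge) // divr_ge0.
have b0 : 0 <= b by rewrite divr_ge0 // ltW.
have x_ge0 (c t : R) : 0 <= c -> 0 <= t -> 0 <= c * (1 - gamma) * t / k ^+ 3.
  by move=> c_ge0 t_ge0; rewrite divr_ge0 ?mulr_ge0 // ltW.
have eta01 t : (t <= T)%N -> 0 <= eta t <= 1.
  move=> tT; have /andP[lo hi] := eta_bounds t tT; apply/andP; split.
    apply: le_trans lo; rewrite divr_ge0 // addr_ge0 // x_ge0 ?ler0n //.
    exact: le_trans (ltW c2_gt0) c21.
  apply: (le_trans hi); have := x_ge0 c2 t%:R (ltW c2_gt0) (ler0n _ _) => x0.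
  by rewrite ler_pdivrMr ?mul1r ?lerDl // ltr_pwDl.
have eta_le t : (T./2 < t <= T)%N -> eta t <= etab.
  move=> /andP[tT2 tT]; have /andP[_ hi] := eta_bounds t tT.
  have t_ge := half_le_tail R tT2; have t0 : 0 < t%:R :> R by apply: lt_le_trans t_ge; rewrite divr_gt0.
  apply: (le_trans hi).
  have -> : etab = 1 / (c2 * (1 - gamma) * (N / 2) / k ^+ 3).
    by rewrite /etab; field; rewrite !lt0r_neq0.
  have p0 : 0 < c2 * (1 - gamma) * (N / 2) / k ^+ 3.
    by rewrite divr_gt0 // mulr_gt0 ?divr_gt0 // mulr_gt0.
  have p1 : c2 * (1 - gamma) * (N / 2) / k ^+ 3 <= c2 * (1 - gamma) * t%:R / k ^+ 3.
    by rewrite ler_pM2r ?invr_gt0 // ler_pM2l // mulr_gt0.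
  move: p0 p1; move: (c2 * (1 - gamma) * (N / 2) / k ^+ 3) (c2 * (1 - gamma) * t%:R / k ^+ 3) => x y p0 p1.
  have xy : x <= 1 + y by apply: (le_trans p1); rewrite lerDr.
  by rewrite !div1r lef_pV2 ?posrE // (lt_le_trans p0).
have kapE : kap * gamma ^+ 2 = 2 * lam by rewrite /kap /lam; field.
have gap_neq0 : 1 - gamma != 0 by rewrite lt0r_neq0.
have small_gain : (4 * kap + 2 * lam) * (1 / (1 - gamma)) <= (1 - gamma) / 4.
  have -> : (4 * kap + 2 * lam) * (1 / (1 - gamma))
      = (1 - gamma) * mn * (4 + gamma ^+ 2) / 20 by rewrite /kap /lam; field.
  have : (1 - gamma) * mn <= 1 - gamma by rewrite ler_piMr // ltW.
  have : gamma ^+ 2 <= 1 by rewrite exprn_ile1 // ltW.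
  move=> i1 i2; have : (1 - gamma) * mn * (4 + gamma ^+ 2) <= (1 - gamma) * 5.
    apply: ler_pM => //; [by rewrite mulr_ge0 // ltW|by rewrite addr_ge0 ?sqr_ge0|].
    move: i1; clear; move=> *; lra.
  clear; move=> *; lra.
(* The fourth power arises here: [b] has [(1 - gamma) ^+ 3] in its denominator and must be below a
   multiple of [(1 - gamma) * eps]. *)
have b_le : b <= (1 - gamma) * eps / 4.
  have bE : b = 160 * (k ^+ 3 * L) / (c2 * (N * (gamma ^+ 2 * (1 - gamma) ^+ 3 * mn))).
    rewrite /b /theta /lam /etab; field.
    by rewrite gap_neq0 !lt0r_neq0.
  have den0 : 0 < c2 * (N * (gamma ^+ 2 * (1 - gamma) ^+ 3 * mn)).
    by rewrite !mulr_gt0 ?exprn_gt0.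
  rewrite bE ler_pdivrMr //.
  have i1 : k ^+ 3 * L <= 4 * (k ^+ 4 * L0).
    have -> : 4 * (k ^+ 4 * L0) = (k ^+ 3 * (2 * k)) * (2 * L0) by ring.
    apply: ler_pM => //; [exact: ltW| |].
      rewrite ler_peMr ?(ltW k3) //; move: k_ge; clear; move=> *; lra.
    rewrite /L; move: ln2_le; clear; move=> *; lra.
  have i2 : k ^+ 4 * L0 * (40 * 64 / c2) <= k ^+ 4 * L0 * (40 * 64 / c2 + 128).
    by apply: ler_wpM2l => //; rewrite lerDl ler0n.
  have i3 : k ^+ 4 * L0 * (40 * 64)
     <= c2 * (N * ((1 - gamma) * (mn * eps) * (gamma ^+ 2 * (1 - gamma) ^+ 3))).
    apply: le_trans (ler_wpM2l (ltW c2_gt0) (le_trans i2 kL)).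
    by rewrite le_eqVlt; apply/orP; left; apply/eqP; field; exact: lt0r_neq0.
  have -> : (1 - gamma) * eps / 4 * (c2 * (N * (gamma ^+ 2 * (1 - gamma) ^+ 3 * mn)))
    = c2 * (N * ((1 - gamma) * (mn * eps) * (gamma ^+ 2 * (1 - gamma) ^+ 3))) / 4 by ring.
  move: i1 i3; clear; move=> *; lra.
(* In units of [(1 - gamma) * eps] this is [1 / 10 + 1 / 4 <= 3 / 8], with steady level
   [C = eps / 2]. *)
have small_bias : 2 * kap * (1 / (1 - gamma)) + b <= 3 / 4 * (1 - gamma) * (eps / 2).
  have -> : 2 * kap * (1 / (1 - gamma)) = (1 - gamma) * mn / 10 by rewrite /kap; field.
  have i0 : 0 <= (1 - gamma) * eps by rewrite mulr_ge0 // ltW.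
  have : (1 - gamma) * mn <= (1 - gamma) * eps by rewrite ler_pM2l.
  have -> : 3 / 4 * (1 - gamma) * (eps / 2) = 3 / 8 * ((1 - gamma) * eps) by field.
  move: b_le i0; clear; move=> *; lra.
have lamE : 2 * theta * etab = lam by rewrite /theta; field; exact: lt0r_neq0.
have thetaH : theta * etab * (1 / (1 - gamma)) <= 1 / 2.
  have -> : theta * etab = lam / 2 by rewrite -lamE; field.
  have : (4 * kap + 2 * lam) * (1 / (1 - gamma)) <= (1 - gamma) / 4 := small_gain.
  rewrite mulrDl; have : 0 <= 4 * kap * (1 / (1 - gamma)).
    by rewrite mulr_ge0 ?(le_trans ler01 h1) // mulr_ge0 // divr_ge0 // mulr_ge0 ?sqr_ge0 // ltW.
  move: gp1; clear; move=> *; lra.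
have transient_small : transient gamma eta T./2 T <= eps / 2.
  pose x := c1 * (1 - gamma) * N / k ^+ 3.
  have x0 : 0 <= x by apply: x_ge0; [exact: le_trans (ltW c2_gt0) c21|exact: ltW].
  have x1 : 0 < 1 + x by rewrite ltr_pwDl.
  have half_T : (T./2 <= T)%N by clear; lia.
  apply: le_trans (transient_le gamma01 eta01 (emin := 1 / (1 + x)) _ half_T) _.
    by move=> t tT; have /andP[] := eta_bounds t tT.
  (* It makes the decay exponent over the second half at least [k = ln T], so the transient is at
     most [2 / (N * (1 - gamma))]. *)
  have kx : k * (1 + x) <= N * (1 - gamma) / 4.
    have -> : k * (1 + x) = k + c1 * ((1 - gamma) * N) / k ^+ 2.
      by rewrite /x; field; exact: lt0r_neq0.
    have : c1 * ((1 - gamma) * N) / k ^+ 2 <= (1 - gamma) * N / 8.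
      rewrite ler_pdivrMr ?exprn_gt0 //.
      have k2 : 1 / 4 <= k ^+ 2 by move: k_ge; rewrite expr2; clear; move=> *; nra.
      have gN : 0 <= (1 - gamma) * N by rewrite mulr_ge0 // ltW.
      have i1 : c1 * ((1 - gamma) * N) <= 1 / 32 * ((1 - gamma) * N) by apply: ler_wpM2r.
      have i2 : (1 - gamma) * N / 8 * (1 / 4) <= (1 - gamma) * N / 8 * k ^+ 2.
        by apply: ler_wpM2l => //; rewrite divr_ge0.
      move: i1 i2; clear; move=> *; lra.
    move: time_large1; clear; move=> *; lra.
  have expo : k <= 1 / (1 + x) * (1 - gamma) / 2 * (T - T./2)%:R.
    apply: (@le_trans _ _ (1 / (1 + x) * (1 - gamma) / 2 * (N / 2))).
      have -> : 1 / (1 + x) * (1 - gamma) / 2 * (N / 2)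
          = (N * (1 - gamma) / 4) / (1 + x) by field; exact: lt0r_neq0.
      by rewrite ler_pdivlMr.
    apply: ler_wpM2l; last exact: half_le_window.
    by rewrite divr_ge0 // mulr_ge0 ?divr_ge0 // ltW.
  have : expR (- (1 / (1 + x) * (1 - gamma) / 2 * (T - T./2)%:R)) <= N^-1.
    have -> : N^-1 = expR (- k) by rewrite expRN lnK.
    by rewrite ler_expR lerN2.
  have gi : 0 <= 2 / (1 - gamma) by rewrite divr_ge0 // ltW.
  move=> /(ler_wpM2l gi) /le_trans; apply.
  have -> : 2 / (1 - gamma) * N^-1 = 2 / (N * (1 - gamma)).
    by field; rewrite gap_neq0 lt0r_neq0.
  rewrite ler_pdivrMr ?mulr_gt0 //.
  move: time_large2; clear; move=> *; lra.
rewrite -[X in 1 - X]expL.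
(* Starting at half time keeps every relevant step size below [etab] and leaves enough steps for the
   error at [T./2] to be forgotten. *)
apply: (prob_event_noise (a0 := a0) (tau := T./2) (etab := etab) kerP r01 gamma01 eta01 Q0_bounds eta_le
  theta0 thetaH L_ge0).
move=> w good; apply: le_sup_err => [|s a]; first exact: ltW.
have half_T : (T./2 <= T <= T)%N by rewrite leqnn andbT; clear; lia.
rewrite lamE in good.
apply: le_trans (error_envelope kerP r01 gamma01 eta01 Q0_bounds (ltW lam0) b0 kapE
  small_gain small_bias good s a half_T) _.
move: transient_small; clear; move=> *; lra.
Qed.
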